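(* Let $d\ge 2$ and let $X_1,\dots,X_d$ be independent random variables with discrete representations given by support vectors $\mathbf{s}^{X_k}\in\mathbb{R}^{n_k}$ and mass vectors $\mathbf{m}^{X_k}\in\mathbb{R}^{n_k}$, $k=1,\dots,d$. Let $\mathcal{S}^Z,\mathcal{M}^Z\in\mathbb{R}^{n_1\times\cdots\times n_d}$ be the support tensor and the probability mass tensor of the sum $Z=\sum_{k=1}^d X_k$. Then $\mathcal{S}^Z$ admits a tensor train representation of rank $2$ and $\mathcal{M}^Z$ admits a tensor train representation of rank $1$; namely, for all $i_1,\dots,i_d$ with $1\le i_k\le n_k$, $$\mathcal{S}^{Z}_{i_1,\dots,i_d}=\mathbf{S}^{(1)}_{i_1}\mathbf{S}^{(2)}_{i_2}\cdots\mathbf{S}^{(d)}_{i_d},\qquad \mathcal{M}^{Z}_{i_1,\dots,i_d}=\mathbf{M}^{(1)}_{i_1}\mathbf{M}^{(2)}_{i_2}\cdots\mathbf{M}^{(d)}_{i_d},$$ where the support cores have slices $$\mathbf{S}^{(1)}_{i_1}=\begin{bmatrix}\mathbf{s}^{X_1}_{i_1}&1\end{bmatrix}\in\mathbb{R}^{1\times 2},\qquad \mathbf{S}^{(k)}_{i_k}=\begin{bmatrix}1&0\\ \mathbf{s}^{X_k}_{i_k}&1\end{bmatrix}\in\mathbb{R}^{2\times2}\ (k=2,\dots,d-1),\qquad \mathbf{S}^{(d)}_{i_d}=\begin{bmatrix}1\\ \mathbf{s}^{X_d}_{i_d}\end{bmatrix}\in\mathbb{R}^{2\times1},$$ and the mass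 cores have slices $\mathbf{M}^{(k)}_{i_k}=\mathbf{m}^{X_k}_{i_k}\in\mathbb{R}^{1\times1}$ for $k=1,\dots,d$.
   Context: A discrete representation of a random variable $X$ consists of a support vector $\mathbf{s}^X=(x_1,\dots,x_{N})^\top\in\mathbb{R}^N$ and a mass vector $\mathbf{m}^X=(m_1,\dots,m_N)^\top\in\mathbb{R}^N$ with $m_i\ge 0$, $\sum_i m_i=1$; it stands for the Dirac mixture $\sum_i m_i\,\delta(x-x_i)$. The $i$-th entries of these vectors are written $\mathbf{s}^X_i$, $\mathbf{m}^X_i$. For an arithmetic operation applied to independent variables $X_1,\dots,X_d$, the support tensor has entries equal to the result of the operation on the support points; for the sum, $\mathcal{S}^Z_{i_1,\dots,i_d}=\sum_{k=1}^d\mathbf{s}^{X_k}_{i_k}$. The probability mass tensor has entries $\mathcal{M}^Z_{i_1,\dots,i_d}=\prod_{k=1}^d\mathbf{m}^{X_k}_{i_k}$. A tensor train (TT) representation of $\mathcal{T}\in\mathbb{R}^{n_1\times\cdots\times n_d}$ is a family of cores $\mathcal{G}^{(k)}\in\mathbb{R}^{r_{k-1}\times n_k\times r_k}$, $r_0=r_d=1$, with matrix slices $\mathbf{G}^{(k)}_{i_k}\in\mathbb{R}^{r_{k-1}\times r_k}$, such that $\mathcal{T}_{i_1,\dots,i_d}=\mathbf{G}^{(1)}_{i_1}\cdots\mathbf{G}^{(d)}_{i_d}$ for all indices ($1\times1$ matrices are identified with scalars). The $r_k$ are the TT-ranks of the representation, and its rank is $\max_k r_k$ (no minimality is asserted).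 *)

(* Defs.v *)
From HB Require Import structures.
From mathcomp Require Import all_boot all_order all_algebra.
From mathcomp Require Import reals.

Set Implicit Arguments.
Unset Strict Implicit.
Unset Printing Implicit Defensive.

Import Order.TTheory GRing.Theory Num.Theory.

Local Open Scope ring_scope.

(* Indices start at 0: ['I_d] is {0, ..., d-1} where the mathematics has
   {1, ..., d}, so the k-th core below has size r_k x r_(k+1). *)

(* The Dirac mixture with weight [dr_mass i 0] at the point [dr_supp i 0].
   Since the masses sum to 1, such a representation exists only for N > 0. *)
Record discrete_repr (R : realType) (N : nat) := DiscreteRepr {
  dr_supp : 'cV[R]_N;
  dr_mass : 'cV[R]_N;
  dr_mass_ge0 : forall i, 0 <= dr_mass i 0;
  dr_mass_sum1 : \sum_i dr_mass i 0 = 1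
}.

Definition tensor (R : realType) (d : nat) (n : 'I_d -> nat) : Type :=
  (forall k : 'I_d, 'I_(n k)) -> R.

Definition sum_support_tensor (R : realType) (d : nat) (n : 'I_d -> nat)
    (X : forall k, discrete_repr R (n k)) : tensor R n :=
  fun i => \sum_k dr_supp (X k) (i k) 0.

(* The joint masses of the tuples of support points; this is where the
   independence of the variables enters. *)
Definition mass_tensor (R : realType) (d : nat) (n : 'I_d -> nat)
    (X : forall k, discrete_repr R (n k)) : tensor R n :=
  fun i => \prod_k dr_mass (X k) (i k) 0.

(* [tt_core k i] is the i-th matrix slice of the k-th core; only the values
   of [tt_r] at 0, ..., d matter. *)
Record tensor_train (R : realType) (d : nat) (n : 'I_d -> nat) := TensorTrain {
  tt_r : nat -> nat;
  tt_r0 : tt_r 0 = 1%N;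
  tt_rd : tt_r d = 1%N;
  tt_core : forall k : 'I_d, 'I_(n k) -> 'M[R]_(tt_r k, tt_r k.+1)
}.

Section TensorTrain.
Variables (R : realType) (d : nat) (n : 'I_d -> nat) (G : tensor_train R n).

(* The product of the slices of the first m cores, at the multi-index i. *)
Fixpoint tt_prefix (i : forall k, 'I_(n k)) (m : nat) :
    (m <= d)%N -> 'M[R]_(tt_r G 0, tt_r G m) :=
  match m return (m <= d)%N -> 'M[R]_(tt_r G 0, tt_r G m) with
  | 0 => fun _ => 1%:M
  | m'.+1 => fun h =>
      tt_prefix i (ltnW h) *m tt_core G (i (Ordinal h))
  end.

(* The full product, as a scalar through its type 'M_(1, 1). *)
Definition tt_eval : tensor R n :=
  fun i => castmx (tt_r0 G, tt_rd G) (tt_prefix i (leqnn d)) 0 0.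

Definition tt_represents (T : tensor R n) : Prop :=
  forall i : (forall k, 'I_(n k)), T i = tt_eval i.

Definition tt_rank : nat := \max_(k < d.+1) tt_r G k.

End TensorTrain.

(* Equality of sizes and of entries, for matrices whose sizes are equal
   but not convertible. *)
Definition same_mx (R : realType) (m n p q : nat)
    (A : 'M[R]_(m, n)) (B : 'M[R]_(p, q)) : Prop :=
  exists e : (m = p) * (n = q), castmx e A = B.

Definition support_slice_first (R : realType) (x : R) : 'M[R]_(1, 2) :=
  row_mx (n1 := 1) (n2 := 1) x%:M 1%:M.

Definition support_slice_mid (R : realType) (x : R) : 'M[R]_(2, 2) :=
  block_mx (m1 := 1) (m2 := 1) (n1 := 1) (n2 := 1) 1%:M 0 x%:M 1%:M.

Definition support_slice_last (R : realType) (x : R) : 'M[R]_(2, 1) :=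
  col_mx (m1 := 1) (m2 := 1) 1%:M x%:M.

Definition mass_slice (R : realType) (x : R) : 'M[R]_(1, 1) := x%:M.

(* Main.v *)
(* The row vector [s 1] carries a partial sum s next to the constant 1, and
   multiplying it by [1 0; x 1] gives [s + x 1]. The first and last support
   slices are the bottom row and the left column of [1 0; x 1]: they select the
   initial state [0 1] and the final component s. *)
Require Import Defs.
From HB Require Import structures.
From mathcomp Require Import all_boot all_order all_algebra.
From mathcomp Require Import reals.

Set Implicit Arguments.
Unset Strict Implicit.
Unset Printing Implicit Defensive.

Import Order.TTheory GRing.Theory Num.Theory.

Local Open Scope ring_scope.

(** Advances the partial sums and products over the first cores by one factor. The index type stays
    ['I_d], filtered by [k < m], because the type of [i k] depends on [k : 'I_d]. *)
Lemma big_ord_ltS (A : Type) (idx : A) (op : Monoid.com_law idx) (d m : nat)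
    (hm : (m < d)%N) (F : 'I_d -> A) :
  \big[op/idx]_(k < d | (k < m.+1)%N) F k
    = op (\big[op/idx]_(k < d | (k < m)%N) F k) (F (Ordinal hm)).
Proof.
rewrite (bigD1 (Ordinal hm)) ?ltnS //= Monoid.mulmC; congr (op _ _).
by apply: eq_bigl => k; rewrite -val_eqE /= ltnS (ltn_neqAle k) andbC.
Qed.

Section SumTrain.
Variables (R : realType) (d : nat) (n : 'I_d -> nat).
Variable X : forall k : 'I_d, discrete_repr R (n k).

Definition sum_rank (k : nat) : nat := if (0 < k < d)%N then 2 else 1.

Lemma sum_rank_d : sum_rank d = 1%N.
Proof. by rewrite /sum_rank ltnn andbF. Qed.

(** These are the entries of [1 0; x 1], indexed by natural numbers so that one formula fills every
    core: the sizes [sum_rank k] do not reduce for a variable [k]. *)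
Definition unitri_entry (x : R) (a b : nat) : R :=
  if a == b then 1 else if (b < a)%N then x else 0.

(* The only row of the first core is the bottom row (index 1) of [1 0; x 1]. *)
Definition sum_row (k a : nat) : nat := if k == 0%N then 1%N else a.

Definition sum_core (k : 'I_d) (i : 'I_(n k)) :
    'M[R]_(sum_rank k, sum_rank k.+1) :=
  \matrix_(a, b) unitri_entry (dr_supp (X k) i 0) (sum_row k a) b.

Definition sum_train : tensor_train R n :=
  @TensorTrain R d n sum_rank erefl sum_rank_d sum_core.

(** The invariant is the row [s 1]; at [m = d] only its column 0 remains, which is the total. The
    case [m = 0] is excluded because the empty product is the 1 x 1 identity, with entry 1 rather
    than the empty sum 0. *)
Lemma sum_train_prefix (i : forall k, 'I_(n k)) (m : nat) (hm : (m <= d)%N)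
    (a : 'I_(sum_rank 0)) (b : 'I_(sum_rank m)) :
  (0 < m)%N ->
  tt_prefix sum_train i hm a b =
    if b == 0%N :> nat then \sum_(k < d | (k < m)%N) dr_supp (X k) (i k) 0
    else 1.
Proof.
elim: m => [//|m IHm] in hm b * => _.
have hb : (b < 2)%N.
  by apply: leq_trans (ltn_ord b) _; rewrite /sum_rank; case: ifP.
rewrite big_ord_ltS /=.
(* The induction effectively starts at one core, whose row is [x 1]. *)
case: m => [|m] in IHm hm b hb *.
  rewrite mul1mx mxE big_pred0 // add0r /unitri_entry /=.
  by case: (nat_of_ord b) hb => [|[]].
rewrite mxE; set s := \sum_(k < d | _) _; set x := dr_supp _ _ _.
(* Extending the summand to all natural numbers lets the bound [sum_rank m.+1] be rewritten to 2, by
   [hm], without casting ordinals. *)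
pose F (j : nat) := (if j == 0%N then s else 1) * unitri_entry x j b.
rewrite (eq_bigr (fun j : 'I_(sum_rank m.+1) => F j)) => [|j _]; last first.
  by rewrite IHm // mxE.
rewrite -(big_mkord xpredT F) {1}/sum_rank hm.
rewrite big_nat_recr //= big_nat1 /F /unitri_entry /=.
by case: (nat_of_ord b) hb => [|[]] //= _; rewrite !(mulr1, mul1r, mulr0, add0r).
Qed.

Lemma sum_train_represents :
  (0 < d)%N -> tt_represents sum_train (sum_support_tensor X).
Proof.
move=> d_gt0 i; rewrite /tt_eval castmxE sum_train_prefix //=.
by apply: eq_bigl => k; rewrite ltn_ord.
Qed.

Lemma sum_train_rank : (1 < d)%N -> tt_rank sum_train = 2%N.
Proof.
move=> d_gt1; apply/eqP; rewrite eqn_leq; apply/andP; split.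
  by apply/bigmax_leqP => k _ /=; rewrite /sum_rank; case: ifP.
(* The maximum 2 is attained at index 1, which is interior since [1 < d]. *)
have h : (1 < d.+1)%N by apply: leqW.
by apply: leq_trans (leq_bigmax (Ordinal h)); rewrite /= /sum_rank d_gt1.
Qed.

Lemma sum_core_first (k : 'I_d) (i : 'I_(n k)) :
  (1 < d)%N -> k = 0%N :> nat ->
  same_mx (sum_core i) (support_slice_first (dr_supp (X k) i 0)).
Proof.
move=> d_gt1 k0.
have e1 : sum_rank k = 1%N by rewrite k0.
have e2 : sum_rank k.+1 = 2%N by rewrite k0 /sum_rank d_gt1.
have rowE c : sum_row k c = 1%N by rewrite /sum_row k0.
exists (e1, e2); apply/matrixP => a b.
rewrite castmxE !mxE rowE /unitri_entry /=.
(* Reading 2 as 1 + 1 splits the column index along the blocks of [row_mx]. *)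
by case: (@splitP 1 1 b) => j ->; rewrite !mxE !ord1.
Qed.

Lemma sum_core_mid (k : 'I_d) (i : 'I_(n k)) :
  (0 < k < d.-1)%N ->
  same_mx (sum_core i) (support_slice_mid (dr_supp (X k) i 0)).
Proof.
case/andP=> k_gt0 k_lt.
have kS_lt : (k.+1 < d)%N by rewrite -ltn_predRL.
have e1 : sum_rank k = 2%N by rewrite /sum_rank k_gt0 ltn_ord.
have e2 : sum_rank k.+1 = 2%N by rewrite /sum_rank kS_lt.
have rowE c : sum_row k c = c by rewrite /sum_row gtn_eqF.
exists (e1, e2); apply/matrixP => a b.
rewrite castmxE !mxE rowE /unitri_entry /=.
case: (@splitP 1 1 a) => a' ->; rewrite !mxE;
  by case: (@splitP 1 1 b) => b' ->; rewrite !mxE !ord1.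
Qed.

Lemma sum_core_last (k : 'I_d) (i : 'I_(n k)) :
  (1 < d)%N -> k = d.-1 :> nat ->
  same_mx (sum_core i) (support_slice_last (dr_supp (X k) i 0)).
Proof.
move=> d_gt1 kd.
have k_gt0 : (0 < k)%N by rewrite kd -ltnS prednK // ltnW.
have e1 : sum_rank k = 2%N by rewrite /sum_rank k_gt0 ltn_ord.
have e2 : sum_rank k.+1 = 1%N by rewrite kd prednK ?sum_rank_d // ltnW.
have rowE c : sum_row k c = c by rewrite /sum_row gtn_eqF.
exists (e1, e2); apply/matrixP => a b.
rewrite castmxE !mxE rowE /unitri_entry /= [b]ord1.
by case: (@splitP 1 1 a) => a' ->; rewrite !mxE !ord1.
Qed.

Definition mass_train : tensor_train R n :=
  @TensorTrain R d n (fun=> 1%N) erefl erefl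
    (fun k i => mass_slice (dr_mass (X k) i 0)).

(** Scalar matrices multiply like their scalars. Here [m = 0] fits, since the empty product of
    masses is 1. *)
Lemma mass_train_prefix (i : forall k, 'I_(n k)) (m : nat) (hm : (m <= d)%N) :
  tt_prefix mass_train i hm =
    (\prod_(k < d | (k < m)%N) dr_mass (X k) (i k) 0)%:M.
Proof.
elim: m => [|m IHm] in hm *; first by rewrite big_pred0.
by rewrite big_ord_ltS /= IHm scalar_mxM.
Qed.

Lemma mass_train_represents : tt_represents mass_train (mass_tensor X).
Proof.
move=> i; rewrite /tt_eval castmxE mass_train_prefix mxE !ord1 eqxx mulr1n.
by apply: eq_bigl => k; rewrite ltn_ord.
Qed.

Lemma mass_train_rank : tt_rank mass_train = 1%N.
Proof.
apply/eqP; rewrite eqn_leq; apply/andP; split; first by apply/bigmax_leqP.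
by rewrite (leq_bigmax (F := fun=> 1%N) (@ord0 d)).
Qed.

End SumTrain.

Theorem theorem3p1 (R : realType) (d : nat) (hd : (2 <= d)%N)
    (n : 'I_d -> nat) (X : forall k : 'I_d, discrete_repr R (n k)) :
  (exists S : tensor_train R n,
     [/\ tt_represents S (sum_support_tensor X),
         tt_rank S = 2%N,
         forall (k : 'I_d) (i : 'I_(n k)), k = 0%N :> nat ->
           same_mx (tt_core S i) (support_slice_first (dr_supp (X k) i 0)),
         forall (k : 'I_d) (i : 'I_(n k)), (0 < k < d.-1)%N ->
           same_mx (tt_core S i) (support_slice_mid (dr_supp (X k) i 0)) &
         forall (k : 'I_d) (i : 'I_(n k)), k = d.-1 :> nat ->
           same_mx (tt_core S i) (support_slice_last (dr_supp (X k) i 0))]) /\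
  (exists M : tensor_train R n,
     [/\ tt_represents M (mass_tensor X),
         tt_rank M = 1%N &
         forall (k : 'I_d) (i : 'I_(n k)),
           same_mx (tt_core M i) (mass_slice (dr_mass (X k) i 0))]).
Proof.
split.
  exists (sum_train X); split=> [||k i k0|k i|k i kd].
  - exact: sum_train_represents (ltnW hd).
  - exact: sum_train_rank.
  - exact: sum_core_first.
  - exact: sum_core_mid.
  - exact: sum_core_last.
exists (mass_train X); split=> [||k i].
- exact: mass_train_represents.
- exact: mass_train_rank.
- by exists (erefl, erefl); apply: castmx_id.
Qed.
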